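(* Let $U\subset\mathbb{C}$ be a neighborhood of $0$ and let $\phi,\psi:U\to\mathbb{C}$ be conformal maps such that $\phi(0)=\psi(0)=0$ and $\phi'(0)=\psi'(0)=1$. Write $\phi(z)=z+az^2+o(z^2)$ and $\psi(z)=z+bz^2+o(z^2)$ as $z\to0$. Then the composition $\psi^{-1}\circ\phi$ (defined near $0$) satisfies $$\psi^{-1}\circ\phi(z)=z+(a-b)z^2+o(z^2)\qquad(z\to0).$$ In particular, the quadratic coefficient is determined by the difference of the second derivatives of $\phi$ and $\psi$ at the origin.
   Context: Conformal maps are injective holomorphic maps; $\psi^{-1}$ is the local inverse of $\psi$ near $0$ with $\psi^{-1}(0)=0$. *)

(* Defs.v *)
From Stdlib Require Import Reals.
From Coquelicot Require Export Coquelicot.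

Open Scope C_scope.

(** A map [U -> C] is represented by a total function [f : C -> C] of which
    only the values on [U] matter.  Differentiability is [ex_derive] over the
    field [C], i.e. complex differentiability.  It is required at the interior
    points of [U] only, so that it never involves the values of [f] outside
    [U]; when [U] is open these are all the points of [U]. *)
Definition holomorphic_on (U : C -> Prop) (f : C -> C) : Prop :=
  forall z : C, locally z U -> ex_derive f z.

Definition injective_on (U : C -> Prop) (f : C -> C) : Prop :=
  forall z w : C, U z -> U w -> f z = f w -> z = w.

Definition conformal_on (U : C -> Prop) (f : C -> C) : Prop :=
  holomorphic_on U f /\ injective_on U f.

(** [f z = z + c z^2 + o(z^2)] as [z -> 0]; [is_domin F u v] means [v = o(u)]
    along the filter [F]. *)
Definition quadratic_expansion (f : C -> C) (c : C) : Prop :=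
  is_domin (locally (RtoC 0)) (fun z : C => z ^ 2)
    (fun z : C => f z - (z + c * z ^ 2)).

(** [g] is a local inverse near [0] of [f : U -> C] (where [f 0 = 0]); only the
    germ of [g] at [0] is constrained. *)
Definition local_inverse_at_0 (U : C -> Prop) (f g : C -> C) : Prop :=
  g 0 = 0 /\
  locally (RtoC 0) (fun z : C => g (f z) = z) /\
  locally (RtoC 0) (fun w : C => U (g w) /\ f (g w) = w).

(* Main.v *)
Require Import Defs.
From Stdlib Require Import Reals Lra Psatz Classical ClassicalEpsilon.
From Coquelicot Require Import Coquelicot.

Local Open Scope C_scope.

(** The expansion of [psi^-1 o phi] is a comparison of coefficients.  If
    [psi (u z) = phi z] with [u z = O(z)], then
    [u + b u^2 + o(z^2) = z + a z^2 + o(z^2)], so [u - z = O(z^2)], hence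
    [u^2 - z^2 = (u - z) (u + z) = o(z^2)] and [u = z + (a - b) z^2 + o(z^2)]
    ([quadratic_expansion_of_lift]).  Two facts of complex analysis are behind
    this: [psi] is onto a neighbourhood of 0, with a preimage of [w] of modulus
    at most [4 |w|], so that the local inverse exists and is [O(w)] whichever
    one is taken; and the derivative of a holomorphic map is differentiable at
    0, with value [2 c] when the quadratic coefficient is [c].

    Both follow from Cauchy's estimate for the derivative.  Let [g] be the
    remainder [f z - z - c z^2], which is [o(z^2)].  The estimate on the disc
    of radius [2 |w|] around [w] gives [g' w = o(w)], that is
    [f' w = 1 + 2 c w + o(w)] ([derivative_of_quadratic_expansion]).  In
    particular [f'] does not vanish near 0.  When [w] is small, the minimum of
    [|f z - w|] over a square is attained in the interior, and it is 0: otherwise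
    a small step in the direction [(w - f z) / f' z] would decrease it ([local_surjectivity]).

    Cauchy's estimate is obtained from Goursat's theorem on rectangles, so no
    regularity of the derivative is assumed.  If [g' 0 = l], the function
    [h z = (g z - g 0 - l z) / z^2] is [o(1/z)] at 0 and holomorphic elsewhere;
    the region between two squares centred at 0 consists of four rectangles which
    avoid 0, so the integral of [h] over the boundary of such a square does not
    depend on the square, and shrinking the square shows that it vanishes.
    Hence [l] times the integral of [1 / z], which is explicitly bounded below,
    equals the integral of [(g z - g 0) / z^2], and this bounds [l]
    ([cauchy_estimate]).

    Goursat's theorem and the existence of minima both rest on one bisection
    principle, [rectangle_subdivision]. *)

(** * Moduli and complex derivatives *)

Lemma Cmod_le_Rabs_sum (z : C) : (Cmod z <= Rabs (fst z) + Rabs (snd z))%R.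
Proof.
destruct z as [x y]; simpl.
replace ((x, y) : C) with (RtoC x + Ci * RtoC y).
2:{ unfold Cplus, Cmult, RtoC, Ci; simpl; f_equal; ring. }
eapply Rle_trans; [apply Cmod_triangle|].
rewrite Cmod_mult, Cmod_Ci, !Cmod_R. lra.
Qed.

Lemma Rabs_snd_le_Cmod (z : C) : (Rabs (snd z) <= Cmod z)%R.
Proof. eapply Rle_trans; [apply Rmax_r|apply Rmax_Cmod]. Qed.

Lemma Rabs_fst_le_Cmod (z : C) : (Rabs (fst z) <= Cmod z)%R.
Proof. eapply Rle_trans; [apply Rmax_l|apply Rmax_Cmod]. Qed.

Lemma Cmod_triangle_minus (x y : C) : (Cmod (x - y) <= Cmod x + Cmod y)%R.
Proof. rewrite <- (Cmod_opp y). apply Cmod_triangle. Qed.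

Lemma Cmod_reverse_triangle (x y : C) : (Cmod x <= Cmod (x - y) + Cmod y)%R.
Proof. replace x with ((x - y) + y) at 1 by ring. apply Cmod_triangle. Qed.

Lemma Cmod_minus_in_rectangle (x1 x2 y1 y2 x y p q : R) :
  (x1 <= x <= x2)%R -> (x1 <= p <= x2)%R -> (y1 <= y <= y2)%R -> (y1 <= q <= y2)%R ->
  (Cmod (((x, y) : C) - (p, q)) <= (x2 - x1) + (y2 - y1))%R.
Proof.
intros Hx Hp Hy Hq. eapply Rle_trans; [apply Cmod_le_Rabs_sum|]. simpl.
apply Rplus_le_compat; apply Rabs_le; lra.
Qed.

(** Complex differentiability with the modulus written out: the remainder bound
    is what the integral estimates consume directly. *)
Definition has_cderiv (f : C -> C) (p l : C) : Prop :=
  forall eps : R, (0 < eps)%R -> exists delta : R, (0 < delta)%R /\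
    forall z : C, (Cmod (z - p) < delta)%R ->
      (Cmod (f z - f p - l * (z - p)) <= eps * Cmod (z - p))%R.

Lemma locally_Cmod (w : C) (P : C -> Prop) :
  locally w P <->
  exists delta : R, (0 < delta)%R /\ forall z, (Cmod (z - w) < delta)%R -> P z.
Proof.
split.
- intros H.
  destruct (locally_norm_le_locally (V := C_NormedModule) w P H) as [d Hd].
  exists d; split; [apply cond_pos|]. intros z Hz. apply Hd. exact Hz.
- intros [d [Hd H]].
  apply (locally_le_locally_norm (V := C_NormedModule) w P).
  exists (mkposreal d Hd). intros z Hz. apply H. exact Hz.
Qed.

Lemma is_derive_has_cderiv (f : C -> C) (p l : C) :
  is_derive f p l <-> has_cderiv f p l.
Proof.
split.
- intros [_ H] eps Heps.
  specialize (H p (fun P HP => HP) (mkposreal eps Heps)).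
  apply locally_C, locally_Cmod in H.
  destruct H as [d [Hd H]]. exists d; split; [exact Hd|].
  intros z Hz. specialize (H z Hz).
  replace (l * (z - p)) with ((z - p) * l) by ring. exact H.
- intros H. split; [apply is_linear_scal_l|].
  intros x Hx eps.
  assert (Hx' : p = x).
  { apply (is_filter_lim_locally_unique (K := C_AbsRing) (V := AbsRing_NormedModule C_AbsRing) p x).
    exact Hx. }
  subst x. apply locally_C, locally_Cmod.
  destruct (H eps (cond_pos eps)) as [d [Hd Hz]].
  exists d; split; [exact Hd|]. intros z Hzd. specialize (Hz z Hzd).
  replace (l * (z - p)) with ((z - p) * l) in Hz by ring. exact Hz.
Qed.

Lemma has_cderiv_continuous (f : C -> C) (p l : C) :
  has_cderiv f p l -> continuous f p.
Proof.
intros H P HP. apply locally_Cmod in HP. destruct HP as [e [He HP]].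
apply locally_Cmod.
destruct (H 1%R Rlt_0_1) as [d [Hd Hz]].
assert (HK : (0 < 1 + Cmod l)%R) by (pose proof (Cmod_ge_0 l); lra).
exists (Rmin d (e / (1 + Cmod l))). split.
{ apply Rmin_glb_lt; [exact Hd|]. apply Rdiv_lt_0_compat; lra. }
intros z Hzd. apply HP.
specialize (Hz z (Rlt_le_trans _ _ _ Hzd (Rmin_l _ _))).
assert (Hsmall : (Cmod (z - p) * (1 + Cmod l) < e)%R).
{ apply Rlt_div_r; [exact HK|]. exact (Rlt_le_trans _ _ _ Hzd (Rmin_r _ _)). }
pose proof (Cmod_reverse_triangle (f z - f p) (l * (z - p))) as Ht.
rewrite Cmod_mult in Ht. lra.
Qed.

Lemma continuous_Cmod (f : C -> C) (p : C) (eps : R) :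
  continuous f p -> (0 < eps)%R ->
  exists delta : R, (0 < delta)%R /\
    forall z, (Cmod (z - p) < delta)%R -> (Cmod (f z - f p) < eps)%R.
Proof.
intros H Heps. apply (locally_Cmod p (fun z => (Cmod (f z - f p) < eps)%R)).
apply (H (fun y => (Cmod (y - f p) < eps)%R)). apply locally_Cmod. exists eps. tauto.
Qed.

(** The product rule for [is_derive] is stated for maps into the absolute ring
    itself, whose uniform structure is given by discs, whereas [C] as a normed
    module carries the uniform structure of the plane.  The two derivatives
    agree because both remainders are measured by [Cmod]. *)
Lemma has_cderiv_is_derive_absring (f : C -> C) (p l : C) :
  has_cderiv f p l <->
  is_derive (K := C_AbsRing) (V := AbsRing_NormedModule C_AbsRing) f p l.
Proof.
rewrite <- is_derive_has_cderiv.
split; intros [_ H]; (split; [apply is_linear_scal_l|exact H]).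
Qed.

Lemma has_cderiv_mult (f g : C -> C) (p l m : C) :
  has_cderiv f p l -> has_cderiv g p m ->
  has_cderiv (fun z => f z * g z) p (l * g p + f p * m).
Proof.
intros Hf Hg. apply has_cderiv_is_derive_absring in Hf, Hg.
apply has_cderiv_is_derive_absring.
apply (is_derive_mult (K := C_AbsRing) f g p l m Hf Hg). intros; apply Cmult_comm.
Qed.

Lemma has_cderiv_minus (f g : C -> C) (p l m : C) :
  has_cderiv f p l -> has_cderiv g p m ->
  has_cderiv (fun z => f z - g z) p (l - m).
Proof.
intros Hf Hg. apply has_cderiv_is_derive_absring in Hf, Hg.
apply has_cderiv_is_derive_absring.
apply (is_derive_minus (K := C_AbsRing) (V := AbsRing_NormedModule C_AbsRing) f g p l m Hf Hg).
Qed.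

Lemma has_cderiv_polynomial (c0 c1 c2 p : C) :
  has_cderiv (fun z => c0 + c1 * z + c2 * z ^ 2) p (c1 + c2 * (2 * p)).
Proof.
intros eps Heps.
assert (HK : (0 < Cmod c2 + 1)%R) by (pose proof (Cmod_ge_0 c2); lra).
exists (eps / (Cmod c2 + 1))%R. split; [apply Rdiv_lt_0_compat; lra|].
intros z Hz. apply Rlt_div_r in Hz; [|exact HK].
replace (_ - _ - _) with ((c2 * (z - p)) * (z - p)) by ring.
rewrite !Cmod_mult. pose proof (Cmod_ge_0 (z - p)). apply Rmult_le_compat_r; lra.
Qed.

Lemma has_cderiv_inv (p : C) : p <> 0 -> has_cderiv Cinv p (- / p ^ 2).
Proof.
intros Hp eps Heps.
pose proof (proj1 (Cmod_gt_0 p) Hp) as Hp'.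
set (K := (eps * Cmod p ^ 3 / 2)%R).
assert (HK : (0 < K)%R) by (unfold K; pose proof (pow_lt _ 3 Hp'); nra).
exists (Rmin (Cmod p / 2) K). split; [apply Rmin_glb_lt; lra|].
intros z Hz.
pose proof (Rlt_le_trans _ _ _ Hz (Rmin_l _ _)) as H1.
pose proof (Rlt_le_trans _ _ _ Hz (Rmin_r _ _)) as H2.
assert (Hzp : (Cmod p / 2 < Cmod z)%R).
{ pose proof (Cmod_reverse_triangle p z) as T.
  replace (p - z) with (- (z - p)) in T by ring. rewrite Cmod_opp in T. lra. }
assert (Hz0 : z <> 0) by (apply Cmod_gt_0; lra).
replace (/ z - / p - - / p ^ 2 * (z - p)) with ((z - p) * / (z * p ^ 2) * (z - p))
  by (field; split; assumption).
rewrite !Cmod_mult, Cmod_inv, Cmod_mult, Cmod_pow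
  by (apply Cmult_neq_0; [assumption|apply Cpow_nz; assumption]).
apply Rmult_le_compat_r; [apply Cmod_ge_0|].
assert (Hq : (0 < Cmod z * Cmod p ^ 2)%R) by (pose proof (pow_lt _ 2 Hp'); nra).
apply Rle_div_l; [exact Hq|].
assert (Hk : (K <= eps * (Cmod z * Cmod p ^ 2))%R); [|lra].
unfold K. pose proof (pow_lt _ 2 Hp') as Hp2.
replace (eps * Cmod p ^ 3 / 2)%R with (eps * (Cmod p / 2 * Cmod p ^ 2))%R by (simpl; field).
apply Rmult_le_compat_l; [lra|]. apply Rmult_le_compat_r; lra.
Qed.

Lemma has_cderiv_translate (f : C -> C) (w p l : C) :
  has_cderiv f (w + p) l -> has_cderiv (fun z => f (w + z)) p l.
Proof.
intros H eps Heps. destruct (H eps Heps) as [d [Hd Hz]].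
exists d; split; [exact Hd|]. intros z Hzp.
specialize (Hz (w + z)). replace (w + z - (w + p)) with (z - p) in Hz by ring. auto.
Qed.

Lemma quadratic_expansion_Cmod (f : C -> C) (c : C) :
  quadratic_expansion f c <->
  forall eps : R, (0 < eps)%R -> exists delta : R, (0 < delta)%R /\
    forall z : C, (Cmod z < delta)%R ->
      (Cmod (f z - (z + c * z ^ 2)) <= eps * Cmod z ^ 2)%R.
Proof.
split.
- intros H eps Heps. specialize (H (mkposreal eps Heps)).
  apply locally_Cmod in H. destruct H as [d [Hd H]].
  exists d; split; [exact Hd|]. intros z Hz.
  rewrite <- Cmod_pow. apply H. replace (z - 0) with z by ring. exact Hz.
- intros H eps. apply locally_Cmod.
  destruct (H eps (cond_pos eps)) as [d [Hd Hz]].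
  exists d; split; [exact Hd|]. intros z Hzd.
  specialize (Hz z). rewrite <- Cmod_pow in Hz. apply Hz.
  replace z with (z - 0) by ring. exact Hzd.
Qed.

Lemma Cmod_le_twice_near_0 (f : C -> C) :
  f 0 = 0 -> has_cderiv f 0 1 ->
  exists rho : R, (0 < rho)%R /\ forall z, (Cmod z < rho)%R ->
    (Cmod z / 2 <= Cmod (f z) <= 2 * Cmod z)%R.
Proof.
intros Hf0 Hf. destruct (Hf (1 / 2)%R ltac:(lra)) as [d [Hd Hz]].
exists d; split; [exact Hd|]. intros z Hzd. specialize (Hz z).
rewrite Hf0 in Hz. replace (z - 0) with z in Hz by ring. specialize (Hz Hzd).
replace (f z - 0 - 1 * z) with (f z - z) in Hz by ring.
pose proof (Cmod_reverse_triangle (f z) z) as K1.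
pose proof (Cmod_reverse_triangle z (f z)) as K2.
replace (z - f z) with (- (f z - z)) in K2 by ring. rewrite Cmod_opp in K2.
split; lra.
Qed.

(** * Subdivision of rectangles *)

Lemma halving_sequence_limit (u v : nat -> R) :
  (u O <= v O)%R ->
  (forall n, u n <= u (S n) /\ v (S n) <= v n /\ v (S n) - u (S n) = (v n - u n) / 2)%R ->
  exists l : R, (forall n, u n <= l <= v n)%R /\
    forall delta : R, (0 < delta)%R -> exists N, forall n, (N <= n)%nat -> (v n - u n < delta)%R.
Proof.
intros H0 H.
assert (Hw : forall n, (v n - u n = (v O - u O) * (/2) ^ n)%R).
{ induction n as [|n IH]; [simpl; ring|].
  destruct (H n) as [_ [_ E]]. rewrite E, IH. simpl. field. }
assert (Hp : forall n, (0 < (/2) ^ n)%R) by (intros n; apply pow_lt; lra).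
assert (Huv : forall n, (u n <= v n)%R).
{ intros n. specialize (Hw n). specialize (Hp n). nra. }
assert (Hvd : forall n, (v n <= v O)%R).
{ induction n as [|n IH]; [lra|]. destruct (H n) as [_ [E _]]. lra. }
assert (Hlim : is_lim_seq (fun n => v n - u n)%R 0).
{ apply (is_lim_seq_ext (fun n => (v O - u O) * (/2) ^ n)%R).
  - intros n; symmetry; apply Hw.
  - replace (Finite 0) with (Rbar_mult (v O - u O)%R 0) by (simpl; f_equal; ring).
    apply is_lim_seq_scal_l, is_lim_seq_geom. rewrite Rabs_pos_eq; lra. }
destruct (ex_finite_lim_seq_incr u (v O)) as [l Hl].
- intros n; apply H.
- intros n; eapply Rle_trans; [apply Huv|apply Hvd].
- exists l; split.
  + intros n; split.
    * apply (is_lim_seq_incr_compare u l Hl). intros k; apply H.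
    * apply (is_lim_seq_decr_compare v l); [|intros k; apply H].
      apply (is_lim_seq_ext (fun n => u n + (v n - u n))%R); [intros k; ring|].
      replace (Finite l) with (Finite (l + 0)%R) by (f_equal; ring).
      apply is_lim_seq_plus'; assumption.
  + intros delta Hd. apply is_lim_seq_spec in Hlim.
    destruct (Hlim (mkposreal delta Hd)) as [N HN]. exists N. intros n Hn.
    specialize (HN n Hn). simpl in HN. rewrite Rminus_0_r in HN.
    apply Rabs_def2 in HN. lra.
Qed.

(** Bundled so that the nested sequence of quarters is defined by recursion. *)
Record rectangle : Type := Rectangle { left_x : R; right_x : R; bottom_y : R; top_y : R }.

(** Cousin's lemma with quartering.  If [Q] failed on the large rectangle it
    would fail on one of its quarters, and so on; the nested rectangles shrink
    to a point [(p, q)] that they all contain, where [Q] holds on small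
    rectangles.  Halving both sides at once is what lets a bound quadratic in
    the size pass from the quarters to the whole; the condition that the small
    rectangles contain [(p, q)] is what lets such a bound come from
    differentiability at [(p, q)]. *)
Theorem rectangle_subdivision (Q : R -> R -> R -> R -> Prop) (a b c d : R) :
  (a <= b)%R -> (c <= d)%R ->
  (forall x1 x2 y1 y2 : R, (a <= x1 <= x2)%R -> (x2 <= b)%R -> (c <= y1 <= y2)%R -> (y2 <= d)%R ->
     let xm := ((x1 + x2) / 2)%R in let ym := ((y1 + y2) / 2)%R in
     Q x1 xm y1 ym -> Q xm x2 y1 ym -> Q x1 xm ym y2 -> Q xm x2 ym y2 ->
     Q x1 x2 y1 y2) ->
  (forall p q : R, (a <= p <= b)%R -> (c <= q <= d)%R ->
     exists delta : R, (0 < delta)%R /\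
       forall x1 x2 y1 y2 : R,
         (a <= x1 <= p)%R -> (p <= x2 <= b)%R -> (c <= y1 <= q)%R -> (q <= y2 <= d)%R ->
         (x2 - x1 < delta)%R -> (y2 - y1 < delta)%R -> Q x1 x2 y1 y2) ->
  Q a b c d.
Proof.
intros Hab Hcd Hglue Hloc. apply NNPP; intros Hnot.
pose (bad := fun s : rectangle =>
  (a <= left_x s <= right_x s /\ right_x s <= b /\ c <= bottom_y s <= top_y s /\ top_y s <= d)%R /\
  ~ Q (left_x s) (right_x s) (bottom_y s) (top_y s)).
pose (half := fun s t : rectangle =>
  (left_x s <= left_x t /\ right_x t <= right_x s /\
   right_x t - left_x t = (right_x s - left_x s) / 2)%R /\
  (bottom_y s <= bottom_y t /\ top_y t <= top_y s /\
   top_y t - bottom_y t = (top_y s - bottom_y s) / 2)%R).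
assert (Hstep : forall s, exists t, bad s -> bad t /\ half s t).
{ intros [x1 x2 y1 y2].
  destruct (classic (bad (Rectangle x1 x2 y1 y2))) as [Hb|Hb];
    [|exists (Rectangle x1 x2 y1 y2); intros K; contradiction].
  pose proof Hb as [[Hx [Hx' [Hy Hy']]] HQ]; simpl in Hx, Hx', Hy, Hy', HQ.
  set (xm := ((x1 + x2) / 2)%R). set (ym := ((y1 + y2) / 2)%R).
  assert (K : ~ Q x1 xm y1 ym \/ ~ Q xm x2 y1 ym \/ ~ Q x1 xm ym y2 \/ ~ Q xm x2 ym y2).
  { apply NNPP; intros K. apply HQ, Hglue; trivial; apply NNPP; tauto. }
  destruct K as [K|[K|[K|K]]];
    [ exists (Rectangle x1 xm y1 ym) | exists (Rectangle xm x2 y1 ym)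
    | exists (Rectangle x1 xm ym y2) | exists (Rectangle xm x2 ym y2) ];
    intros _; unfold bad, half; simpl;
    repeat split; trivial; unfold xm, ym; lra. }
pose (next := fun s => proj1_sig (constructive_indefinite_description _ (Hstep s))).
assert (Hnext : forall s, bad s -> bad (next s) /\ half s (next s)).
{ intros s. exact (proj2_sig (constructive_indefinite_description _ (Hstep s))). }
pose (rect_ := fix rect_ n := match n with O => Rectangle a b c d | S k => next (rect_ k) end).
assert (Hbad : forall n, bad (rect_ n)).
{ induction n as [|n IH].
  - unfold bad; simpl; repeat split; trivial; lra.
  - apply Hnext, IH. }
assert (Hhalf : forall n, half (rect_ n) (rect_ (S n))) by (intros n; apply Hnext, Hbad).
destruct (halving_sequence_limit (fun n => left_x (rect_ n)) (fun n => right_x (rect_ n)))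
  as [p [Hp Hpd]]; [exact Hab|intros n; apply Hhalf|].
destruct (halving_sequence_limit (fun n => bottom_y (rect_ n)) (fun n => top_y (rect_ n)))
  as [q [Hq Hqd]]; [exact Hcd|intros n; apply Hhalf|].
destruct (Hloc p q (Hp O) (Hq O)) as [delta [Hd Hsmall]].
destruct (Hpd delta Hd) as [N1 HN1]. destruct (Hqd delta Hd) as [N2 HN2].
set (n := (N1 + N2)%nat).
destruct (Hbad n) as [[Hx [Hx' [Hy Hy']]] HQ].
apply HQ, Hsmall.
- specialize (Hp n); simpl in Hp; lra.
- specialize (Hp n); simpl in Hp; lra.
- specialize (Hq n); simpl in Hq; lra.
- specialize (Hq n); simpl in Hq; lra.
- apply HN1; unfold n; lia.
- apply HN2; unfold n; lia.
Qed.

(** If there is no minimum, every point of the rectangle is beaten by some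
    value of [m], and by semicontinuity so is a whole neighbourhood of it.
    Being beaten by a single value passes from four quarters to their union
    (take the least of the four values), hence holds for the whole rectangle,
    in which the beating point itself lies. *)
Theorem lower_semicontinuous_attains_min (m : C -> R) (a b c d : R) :
  (a <= b)%R -> (c <= d)%R ->
  (forall x y v : R, (a <= x <= b)%R -> (c <= y <= d)%R -> (v < m (x, y))%R ->
     exists delta : R, (0 < delta)%R /\
       forall z : C, (Cmod (z - (x, y)) < delta)%R -> (v < m z)%R) ->
  exists x0 y0 : R, (a <= x0 <= b)%R /\ (c <= y0 <= d)%R /\
    forall x y : R, (a <= x <= b)%R -> (c <= y <= d)%R -> (m (x0, y0) <= m (x, y))%R.
Proof.
intros Hab Hcd Hm. apply NNPP; intros Hno.
assert (Hbelow : forall p q, (a <= p <= b)%R -> (c <= q <= d)%R ->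
  exists x y, (a <= x <= b)%R /\ (c <= y <= d)%R /\ (m (x, y) < m (p, q))%R).
{ intros p q Hp Hq. apply NNPP; intros K. apply Hno. exists p, q.
  repeat split; try lra. intros x y Hx Hy. apply Rnot_lt_le. intros Hlt.
  apply K. exists x, y. tauto. }
assert (Hall : exists x0 y0, (a <= x0 <= b)%R /\ (c <= y0 <= d)%R /\
  forall x y, (a <= x <= b)%R -> (c <= y <= d)%R -> (m (x0, y0) < m (x, y))%R).
{ apply (rectangle_subdivision (fun x1 x2 y1 y2 =>
    exists x0 y0, (a <= x0 <= b)%R /\ (c <= y0 <= d)%R /\
      forall x y, (x1 <= x <= x2)%R -> (y1 <= y <= y2)%R -> (m (x0, y0) < m (x, y))%R) a b c d);
    trivial.
  - intros x1 x2 y1 y2 Hx Hx' Hy Hy' xm ym.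
    assert (Hmin : forall P1 P2 : R -> R -> Prop,
      (exists x0 y0, (a <= x0 <= b)%R /\ (c <= y0 <= d)%R /\
         forall x y, P1 x y -> (m (x0, y0) < m (x, y))%R) ->
      (exists x0 y0, (a <= x0 <= b)%R /\ (c <= y0 <= d)%R /\
         forall x y, P2 x y -> (m (x0, y0) < m (x, y))%R) ->
      exists x0 y0, (a <= x0 <= b)%R /\ (c <= y0 <= d)%R /\
         forall x y, P1 x y \/ P2 x y -> (m (x0, y0) < m (x, y))%R).
    { intros P1 P2 [u1 [v1 [A1 [B1 C1]]]] [u2 [v2 [A2 [B2 C2]]]].
      destruct (Rle_dec (m (u1, v1)) (m (u2, v2))) as [Hle|Hle].
      - exists u1, v1. repeat split; try lra. intros x y [K|K]; auto.
        specialize (C2 x y K). lra.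
      - exists u2, v2. repeat split; try lra. intros x y [K|K]; auto.
        specialize (C1 x y K). lra. }
    intros H1 H2 H3 H4.
    destruct (Hmin (fun x y => ((x1 <= x <= xm) /\ (y1 <= y <= ym)) \/
                               ((xm <= x <= x2) /\ (y1 <= y <= ym)))%R
                   (fun x y => ((x1 <= x <= xm) /\ (ym <= y <= y2)) \/
                               ((xm <= x <= x2) /\ (ym <= y <= y2)))%R) as [x0 [y0 [K1 [K2 K3]]]].
    + apply Hmin; [destruct H1 as [u [v [? [? K]]]]|destruct H2 as [u [v [? [? K]]]]];
        exists u, v; repeat split; try lra; intros x y [? ?]; auto.
    + apply Hmin; [destruct H3 as [u [v [? [? K]]]]|destruct H4 as [u [v [? [? K]]]]];
        exists u, v; repeat split; try lra; intros x y [? ?]; auto.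
    + exists x0, y0. repeat split; try lra. intros x y Hxx Hyy. apply K3.
      destruct (Rle_dec x xm); destruct (Rle_dec y ym); lra.
  - intros p q Hp Hq.
    destruct (Hbelow p q Hp Hq) as [x0 [y0 [Hx0 [Hy0 Hlt]]]].
    destruct (Hm p q _ Hp Hq Hlt) as [delta [Hd Hdelta]].
    exists (delta / 2)%R. split; [lra|].
    intros x1 x2 y1 y2 Hx1 Hx2 Hy1 Hy2 Hw Hh.
    exists x0, y0. repeat split; try lra. intros x y Hx Hy. apply Hdelta.
    eapply Rle_lt_trans; [apply (Cmod_minus_in_rectangle x1 x2 y1 y2); lra|]. lra. }
destruct Hall as [x0 [y0 [Hx0 [Hy0 Hlt]]]].
specialize (Hlt x0 y0 Hx0 Hy0). lra.
Qed.

(** * Integrals along the boundary of a rectangle *)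

Definition horizontal_integral (G : C -> C) (y x1 x2 : R) : C :=
  RInt (V := C_R_CompleteNormedModule) (fun x => G (x, y)) x1 x2.

Definition vertical_integral (G : C -> C) (x y1 y2 : R) : C :=
  RInt (V := C_R_CompleteNormedModule) (fun y => G (x, y)) y1 y2.

(** The counterclockwise contour integral over the boundary of
    [[a, b] x [c, d]]: on the vertical sides [dz = i dy]. *)
Definition rectangle_integral (G : C -> C) (a b c d : R) : C :=
  horizontal_integral G c a b - horizontal_integral G d a b +
  Ci * (vertical_integral G b c d - vertical_integral G a c d).

Lemma continuous_horizontal (G : C -> C) (x y : R) :
  continuous G ((x, y) : C) ->
  continuous (U := C_R_CompleteNormedModule) (fun t : R => G (t, y)) x.
Proof.
intros H.
apply (continuous_comp_2 (X := C_R_CompleteNormedModule) (fun t : R => t) (fun _ => y) (fun s t => G (s, t)) x).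
- apply continuous_id.
- apply continuous_const.
- apply (continuous_ext G); [intros [? ?]; reflexivity|exact H].
Qed.

Lemma continuous_vertical (G : C -> C) (x y : R) :
  continuous G ((x, y) : C) ->
  continuous (U := C_R_CompleteNormedModule) (fun t : R => G (x, t)) y.
Proof.
intros H.
apply (continuous_comp_2 (X := C_R_CompleteNormedModule) (fun _ => x) (fun t : R => t) (fun s t => G (s, t)) y).
- apply continuous_const.
- apply continuous_id.
- apply (continuous_ext G); [intros [? ?]; reflexivity|exact H].
Qed.

Lemma ex_RInt_horizontal (G : C -> C) (y a b : R) :
  (a <= b)%R -> (forall x, (a <= x <= b)%R -> continuous G ((x, y) : C)) ->
  ex_RInt (V := C_R_CompleteNormedModule) (fun x => G (x, y)) a b.
Proof.
intros Hab H. apply ex_RInt_continuous. intros z Hz.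
rewrite Rmin_left, Rmax_right in Hz by exact Hab.
apply continuous_horizontal, H, Hz.
Qed.

Lemma ex_RInt_vertical (G : C -> C) (x c d : R) :
  (c <= d)%R -> (forall y, (c <= y <= d)%R -> continuous G ((x, y) : C)) ->
  ex_RInt (V := C_R_CompleteNormedModule) (fun y => G (x, y)) c d.
Proof.
intros Hcd H. apply ex_RInt_continuous. intros z Hz.
rewrite Rmin_left, Rmax_right in Hz by exact Hcd.
apply continuous_vertical, H, Hz.
Qed.

Lemma RInt_near_constant (f g : R -> C) (a b M : R) (k : C) :
  (a <= b)%R ->
  ex_RInt (V := C_R_CompleteNormedModule) f a b ->
  ex_RInt (V := C_R_CompleteNormedModule) g a b ->
  (forall x, (a <= x <= b)%R -> (Cmod (f x - g x - k) <= M)%R) ->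
  (Cmod (RInt (V := C_R_CompleteNormedModule) f a b -
         RInt (V := C_R_CompleteNormedModule) g a b - RtoC (b - a) * k) <= (b - a) * M)%R.
Proof.
intros Hab Hf Hg HM.
apply RInt_correct in Hf. apply RInt_correct in Hg.
pose proof (is_RInt_minus _ _ _ _ _ _ (is_RInt_minus _ _ _ _ _ _ Hf Hg)
  (is_RInt_const (V := C_R_NormedModule) a b k)) as H.
assert (E : forall z : C, norm (V := C_R_NormedModule) z = Cmod z).
{ intros z. symmetry; apply Cmod_norm. }
pose proof (norm_RInt_le_const _ a b _ M Hab
  (fun x Hx => Rle_trans _ _ _ (Req_le _ _ (E _)) (HM x Hx)) H) as K.
rewrite E in K.
replace (RtoC (b - a) * k) with (scal (V := C_R_NormedModule) (b - a)%R k); [exact K|].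
apply scal_R_Cmult.
Qed.
(** The two integrals over the cut cancel; only the horizontal sides have to be
    split. *)
Lemma rectangle_integral_cut_vertical (G : C -> C) (a m b c d : R) :
  (a <= m <= b)%R ->
  (forall x, (a <= x <= b)%R -> continuous G ((x, c) : C) /\ continuous G ((x, d) : C)) ->
  rectangle_integral G a b c d = rectangle_integral G a m c d + rectangle_integral G m b c d.
Proof.
intros [Ham Hmb] H.
assert (K : forall y, y = c \/ y = d ->
  horizontal_integral G y a b = horizontal_integral G y a m + horizontal_integral G y m b).
{ intros y Hy. symmetry.
  apply (RInt_Chasles (V := C_R_CompleteNormedModule) (fun x => G (x, y)) a m b);
    apply ex_RInt_horizontal; trivial;
    intros x Hx; destruct (H x) as [H1 H2]; try lra; destruct Hy as [-> | ->]; trivial. }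
unfold rectangle_integral. rewrite (K c), (K d) by tauto. ring.
Qed.

Lemma rectangle_integral_cut_horizontal (G : C -> C) (a b c m d : R) :
  (c <= m <= d)%R ->
  (forall y, (c <= y <= d)%R -> continuous G ((a, y) : C) /\ continuous G ((b, y) : C)) ->
  rectangle_integral G a b c d = rectangle_integral G a b c m + rectangle_integral G a b m d.
Proof.
intros [Hcm Hmd] H.
assert (K : forall x, x = a \/ x = b ->
  vertical_integral G x c d = vertical_integral G x c m + vertical_integral G x m d).
{ intros x Hx. symmetry.
  apply (RInt_Chasles (V := C_R_CompleteNormedModule) (fun y => G (x, y)) c m d);
    apply ex_RInt_vertical; trivial;
    intros y Hy; destruct (H y) as [H1 H2]; try lra; destruct Hx as [-> | ->]; trivial. }
unfold rectangle_integral. rewrite (K a), (K b) by tauto. ring.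
Qed.

(** The one estimate used for contour integrals.  Opposite sides are compared
    pointwise, which cancels the constant part of [G] before any norm is taken;
    the constants [k] and [l] are what an affine or explicitly known part of
    [G] contributes to the two differences. *)
Lemma rectangle_integral_near_constant (G : C -> C) (a b c d M N : R) (k l : C) :
  (a <= b)%R -> (c <= d)%R ->
  (forall x, (a <= x <= b)%R -> continuous G ((x, c) : C) /\ continuous G ((x, d) : C)) ->
  (forall y, (c <= y <= d)%R -> continuous G ((a, y) : C) /\ continuous G ((b, y) : C)) ->
  (forall x, (a <= x <= b)%R -> (Cmod (G (x, c) - G (x, d) - k) <= M)%R) ->
  (forall y, (c <= y <= d)%R -> (Cmod (G (b, y) - G (a, y) - l) <= N)%R) ->
  (Cmod (rectangle_integral G a b c d - (RtoC (b - a) * k + Ci * (RtoC (d - c) * l)))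
   <= (b - a) * M + (d - c) * N)%R.
Proof.
intros Hab Hcd Hx Hy HM HN.
pose proof (RInt_near_constant (fun x => G (x, c)) (fun x => G (x, d)) a b M k Hab
  (ex_RInt_horizontal G c a b Hab (fun x Hx' => proj1 (Hx x Hx')))
  (ex_RInt_horizontal G d a b Hab (fun x Hx' => proj2 (Hx x Hx'))) HM) as H1.
pose proof (RInt_near_constant (fun y => G (b, y)) (fun y => G (a, y)) c d N l Hcd
  (ex_RInt_vertical G b c d Hcd (fun y Hy' => proj2 (Hy y Hy')))
  (ex_RInt_vertical G a c d Hcd (fun y Hy' => proj1 (Hy y Hy'))) HN) as H2.
change (RInt (V := C_R_CompleteNormedModule) (fun x => G (x, c)) a b)
  with (horizontal_integral G c a b) in H1.
change (RInt (V := C_R_CompleteNormedModule) (fun x => G (x, d)) a b)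
  with (horizontal_integral G d a b) in H1.
change (RInt (V := C_R_CompleteNormedModule) (fun y => G (b, y)) c d)
  with (vertical_integral G b c d) in H2.
change (RInt (V := C_R_CompleteNormedModule) (fun y => G (a, y)) c d)
  with (vertical_integral G a c d) in H2.
unfold rectangle_integral.
match type of H1 with (Cmod ?u <= _)%R => match type of H2 with (Cmod ?v <= _)%R =>
  match goal with |- (Cmod ?w <= _)%R => replace w with (u + Ci * v) by ring end end end.
eapply Rle_trans; [apply Cmod_triangle|].
rewrite Cmod_mult, Cmod_Ci, Rmult_1_l. apply Rplus_le_compat; assumption.
Qed.

(** * Goursat's theorem and Cauchy's estimate *)

(** The property propagated by subdivision is
    [|integral| <= 2 eps (width + height)^2]: its right-hand side is divided
    by exactly 4 on each quarter.  Near a point of differentiability it holds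
    because the affine part of [G] integrates to 0, the remainder is at most
    [eps (width + height)], and it is integrated over two pairs of sides. *)
Theorem goursat_rectangle (G : C -> C) (a b c d : R) :
  (a <= b)%R -> (c <= d)%R ->
  (forall x y, (a <= x <= b)%R -> (c <= y <= d)%R -> exists l, has_cderiv G ((x, y) : C) l) ->
  rectangle_integral G a b c d = 0.
Proof.
intros Hab Hcd HG.
assert (Hc : forall x y, (a <= x <= b)%R -> (c <= y <= d)%R -> continuous G ((x, y) : C)).
{ intros x y Hx Hy. destruct (HG x y Hx Hy) as [l Hl]. eapply has_cderiv_continuous, Hl. }
assert (Hsmall : forall eps : R, (0 < eps)%R ->
  (Cmod (rectangle_integral G a b c d) <= 2 * eps * ((b - a) + (d - c)) ^ 2)%R).
{ intros eps Heps.
  apply (rectangle_subdivision (fun x1 x2 y1 y2 =>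
    (Cmod (rectangle_integral G x1 x2 y1 y2) <= 2 * eps * ((x2 - x1) + (y2 - y1)) ^ 2)%R));
    trivial.
  - intros x1 x2 y1 y2 Hx Hx' Hy Hy' xm ym H1 H2 H3 H4.
    assert (Hxm : (x1 <= xm <= x2)%R) by (unfold xm; lra).
    assert (Hym : (y1 <= ym <= y2)%R) by (unfold ym; lra).
    rewrite (rectangle_integral_cut_vertical G x1 xm x2 y1 y2 Hxm)
      by (intros x Hx0; split; apply Hc; lra).
    rewrite (rectangle_integral_cut_horizontal G x1 xm y1 ym y2 Hym)
      by (intros y Hy0; split; apply Hc; lra).
    rewrite (rectangle_integral_cut_horizontal G xm x2 y1 ym y2 Hym)
      by (intros y Hy0; split; apply Hc; lra).
    eapply Rle_trans; [apply Cmod_triangle|].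
    eapply Rle_trans; [apply Rplus_le_compat; apply Cmod_triangle|].
    replace (xm - x1)%R with ((x2 - x1) / 2)%R in * by (unfold xm; field).
    replace (x2 - xm)%R with ((x2 - x1) / 2)%R in * by (unfold xm; field).
    replace (ym - y1)%R with ((y2 - y1) / 2)%R in * by (unfold ym; field).
    replace (y2 - ym)%R with ((y2 - y1) / 2)%R in * by (unfold ym; field).
    nra.
  - intros p q Hp Hq. destruct (HG p q Hp Hq) as [l Hl].
    destruct (Hl eps Heps) as [delta [Hd Hdelta]].
    exists (delta / 2)%R. split; [lra|].
    intros x1 x2 y1 y2 Hx1 Hx2 Hy1 Hy2 Hw Hh.
    set (s := ((x2 - x1) + (y2 - y1))%R).
    assert (Herr : forall x y, (x1 <= x <= x2)%R -> (y1 <= y <= y2)%R ->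
      (Cmod (G (x, y) - G (p, q) - l * (((x, y) : C) - (p, q))) <= eps * s)%R).
    { intros x y Hx Hy.
      assert (K : (Cmod (((x, y) : C) - (p, q)) <= s)%R)
        by (apply Cmod_minus_in_rectangle; lra).
      eapply Rle_trans; [apply Hdelta; unfold s in K; lra|].
      apply Rmult_le_compat_l; lra. }
    pose proof (rectangle_integral_near_constant G x1 x2 y1 y2 (2 * eps * s) (2 * eps * s)
      (l * (Ci * RtoC (y1 - y2))) (l * RtoC (x2 - x1))) as K.
    replace (RtoC (x2 - x1) * (l * (Ci * RtoC (y1 - y2))) +
             Ci * (RtoC (y2 - y1) * (l * RtoC (x2 - x1)))) with (RtoC 0) in K
      by (rewrite !RtoC_minus; ring).
    replace (rectangle_integral G x1 x2 y1 y2 - 0) with (rectangle_integral G x1 x2 y1 y2) in K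
      by ring.
    eapply Rle_trans; [apply K|].
    + lra.
    + lra.
    + intros x Hx; split; apply Hc; lra.
    + intros y Hy; split; apply Hc; lra.
    + intros x Hx.
      replace (G (x, y1) - G (x, y2) - l * (Ci * RtoC (y1 - y2))) with
        ((G (x, y1) - G (p, q) - l * (((x, y1) : C) - (p, q))) -
         (G (x, y2) - G (p, q) - l * (((x, y2) : C) - (p, q)))).
      2:{ replace (Ci * RtoC (y1 - y2)) with (((x, y1) : C) - (x, y2)); [ring|].
          unfold Ci, RtoC, Cminus, Cplus, Copp, Cmult; simpl; f_equal; ring. }
      eapply Rle_trans; [apply Cmod_triangle_minus|].
      pose proof (Herr x y1 Hx ltac:(lra)). pose proof (Herr x y2 Hx ltac:(lra)). lra.
    + intros y Hy.
      replace (G (x2, y) - G (x1, y) - l * RtoC (x2 - x1)) with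
        ((G (x2, y) - G (p, q) - l * (((x2, y) : C) - (p, q))) -
         (G (x1, y) - G (p, q) - l * (((x1, y) : C) - (p, q)))).
      2:{ replace (RtoC (x2 - x1)) with (((x2, y) : C) - (x1, y)); [ring|].
          unfold RtoC, Cminus, Cplus, Copp; simpl; f_equal; ring. }
      eapply Rle_trans; [apply Cmod_triangle_minus|].
      pose proof (Herr x1 y ltac:(lra) Hy). pose proof (Herr x2 y ltac:(lra) Hy). lra.
    + apply Req_le. unfold s. ring. }
apply Cmod_eq_0, Rle_antisym; [|apply Cmod_ge_0].
apply Rle_plus_epsilon. intros e He.
set (s := ((b - a) + (d - c))%R) in *.
assert (Hs : (0 < 2 * s ^ 2 + 1)%R) by nra.
eapply Rle_trans; [apply (Hsmall (e / (2 * s ^ 2 + 1))%R); apply Rdiv_lt_0_compat; lra|].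
rewrite Rplus_0_l.
replace (2 * (e / (2 * s ^ 2 + 1)) * s ^ 2)%R with (e * (2 * s ^ 2) / (2 * s ^ 2 + 1))%R by (field; lra).
apply Rle_div_l; nra.
Qed.

Definition square_integral (G : C -> C) (r : R) : C := rectangle_integral G (- r) r (- r) r.

(** The region between the two squares is cut into four rectangles (left,
    right, below, above) which avoid 0. *)
Lemma square_integral_shrink (G : C -> C) (s r : R) :
  (0 < s <= r)%R ->
  (forall z : C, z <> 0 -> (Rabs (fst z) <= r)%R -> (Rabs (snd z) <= r)%R ->
     exists l, has_cderiv G z l) ->
  square_integral G r = square_integral G s.
Proof.
intros Hs HG.
assert (HD : forall x y, (- r <= x <= r)%R -> (- r <= y <= r)%R ->
  (s <= x \/ x <= - s \/ s <= y \/ y <= - s)%R -> exists l, has_cderiv G ((x, y) : C) l).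
{ intros x y Hx Hy Ho. apply HG; [|apply Rabs_le, Hx|apply Rabs_le, Hy].
  intros E. injection E as E1 E2. lra. }
assert (Hc : forall x y, (- r <= x <= r)%R -> (- r <= y <= r)%R ->
  (s <= x \/ x <= - s \/ s <= y \/ y <= - s)%R -> continuous G ((x, y) : C)).
{ intros x y Hx Hy Ho. destruct (HD x y Hx Hy Ho) as [l Hl].
  eapply has_cderiv_continuous, Hl. }
unfold square_integral.
rewrite (rectangle_integral_cut_vertical G (- r) (- s) r) by
  (try lra; intros x Hx; split; apply Hc; lra).
rewrite (rectangle_integral_cut_vertical G (- s) s r) by
  (try lra; intros x Hx; split; apply Hc; lra).
rewrite (rectangle_integral_cut_horizontal G (- s) s (- r) (- s) r) by
  (try lra; intros x Hx; split; apply Hc; lra).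
rewrite (rectangle_integral_cut_horizontal G (- s) s (- s) s r) by
  (try lra; intros x Hx; split; apply Hc; lra).
rewrite (goursat_rectangle G (- r) (- s) (- r) r) by (try lra; intros x y Hx Hy; apply HD; lra).
rewrite (goursat_rectangle G s r (- r) r) by (try lra; intros x y Hx Hy; apply HD; lra).
rewrite (goursat_rectangle G (- s) s (- r) (- s)) by (try lra; intros x y Hx Hy; apply HD; lra).
rewrite (goursat_rectangle G (- s) s s r) by (try lra; intros x y Hx Hy; apply HD; lra).
ring.
Qed.

Lemma Cmod_ge_on_square_boundary (x y r : R) :
  (0 < r)%R -> (Rabs x = r \/ Rabs y = r) -> (r <= Cmod ((x, y) : C))%R.
Proof.
intros Hr [H|H]; rewrite <- H.
- apply (Rabs_fst_le_Cmod (x, y)).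
- apply (Rabs_snd_le_Cmod (x, y)).
Qed.

(** On the sides of the square of half-side [r], the difference of [1 / z] at
    opposite points is, up to a factor [i], [2 r / (r^2 + t^2)], which lies
    between [1 / r] and [2 / r]; it is compared with the midpoint [3 / (2 r)].
    This replaces the value [2 pi i] of the integral of [1 / z] by the
    approximation [6 i], with error at most 2. *)
Lemma Rabs_kernel_minus_mean (r t : R) : (0 < r)%R -> (- r <= t <= r)%R ->
  (Rabs (2 * r / (r ^ 2 + t ^ 2) - 3 / (2 * r)) <= / (2 * r))%R.
Proof.
intros Hr Ht.
assert (H2 : (0 < r ^ 2 + t ^ 2)%R) by nra.
assert (E1 : (/ r <= 2 * r / (r ^ 2 + t ^ 2))%R).
{ apply Rle_div_r; [exact H2|]. apply Rmult_le_reg_l with r; [exact Hr|].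
  replace (r * (/ r * (r ^ 2 + t ^ 2)))%R with (r ^ 2 + t ^ 2)%R by (field; lra). nra. }
assert (E2 : (2 * r / (r ^ 2 + t ^ 2) <= 2 * / r)%R).
{ apply Rle_div_l; [exact H2|]. apply Rmult_le_reg_l with r; [exact Hr|].
  replace (r * (2 * / r * (r ^ 2 + t ^ 2)))%R with (2 * (r ^ 2 + t ^ 2))%R by (field; lra). nra. }
replace (3 / (2 * r))%R with (3 / 2 * / r)%R by (field; lra).
replace (/ (2 * r))%R with (1 / 2 * / r)%R by (field; lra).
apply Rabs_le. lra.
Qed.

(** The integral of [h z = (g z - g 0 - l z) / z^2] over the boundary of the
    square vanishes.  It is also [- 6 i l] up to an error
    [2 |l| + 16 M / r], the first term being the error in the integral of
    [l / z] and the second bounding the integral of [(g z - g 0) / z^2].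
    Hence [4 |l| <= 16 M / r]. *)
Lemma cauchy_estimate_origin (g : C -> C) (l : C) (r M : R) :
  (0 < r)%R ->
  (forall z : C, (Rabs (fst z) <= r)%R -> (Rabs (snd z) <= r)%R ->
     (exists m, has_cderiv g z m) /\ (Cmod (g z) <= M)%R) ->
  has_cderiv g 0 l ->
  (Cmod l * r <= 4 * M)%R.
Proof.
intros Hr Hg Hl.
set (h := fun z : C => (g z - (g 0 + l * z + 0 * z ^ 2)) * (/ z * / z)).
assert (Hh : forall z : C, z <> 0 -> (Rabs (fst z) <= r)%R -> (Rabs (snd z) <= r)%R ->
  exists m, has_cderiv h z m).
{ intros z Hz Hx Hy. destruct (Hg z Hx Hy) as [[m Hm] _]. eexists.
  apply has_cderiv_mult; [apply has_cderiv_minus; [exact Hm|apply has_cderiv_polynomial]|].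
  apply has_cderiv_mult; apply has_cderiv_inv; exact Hz. }
assert (Hhc : forall s x y, (0 < s <= r)%R -> (- s <= x <= s)%R -> (- s <= y <= s)%R ->
  (Rabs x = s \/ Rabs y = s) -> continuous h ((x, y) : C)).
{ intros s x y Hs Hx Hy Hb.
  destruct (Hh ((x, y) : C)) as [m Hm].
  - apply Cmod_gt_0. eapply Rlt_le_trans; [|apply Cmod_ge_on_square_boundary, Hb]; lra.
  - apply Rabs_le; simpl; lra.
  - apply Rabs_le; simpl; lra.
  - eapply has_cderiv_continuous, Hm. }
assert (Rr : forall s, (0 < s)%R -> Rabs s = s) by (intros; apply Rabs_pos_eq; lra).
assert (Rn : forall s, (0 < s)%R -> Rabs (- s) = s) by (intros; rewrite Rabs_Ropp; auto).
(* on a small square of half-side [s], [|h| <= (e / 8) / s] and the boundary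
   has length [8 s] *)
assert (Hzero : square_integral h r = 0).
{ apply Cmod_eq_0, Rle_antisym; [|apply Cmod_ge_0].
  apply Rle_plus_epsilon. intros e He. rewrite Rplus_0_l.
  destruct (Hl (e / 8)%R ltac:(lra)) as [d [Hd Hdl]].
  set (s := Rmin r (d / 3)).
  assert (Hs : (0 < s <= r)%R).
  { split; [apply Rmin_glb_lt; lra|apply Rmin_l]. }
  assert (Hsd : (s <= d / 3)%R) by apply Rmin_r.
  rewrite (square_integral_shrink h s r Hs Hh).
  assert (Hb : forall x y, (- s <= x <= s)%R -> (- s <= y <= s)%R ->
    (Rabs x = s \/ Rabs y = s) -> (Cmod (h (x, y)) <= e / 8 / s)%R).
  { intros x y Hx Hy Hxy. set (z := ((x, y) : C)).
    assert (Hz : (s <= Cmod z)%R) by (apply Cmod_ge_on_square_boundary; lra).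
    assert (Hz0 : z <> 0) by (apply Cmod_gt_0; lra).
    assert (Hz2 : (Cmod z <= 2 * s)%R).
    { eapply Rle_trans; [apply Cmod_le_Rabs_sum|]. unfold z; simpl.
      assert (Rabs x <= s)%R by (apply Rabs_le; lra).
      assert (Rabs y <= s)%R by (apply Rabs_le; lra). lra. }
    unfold h. rewrite !Cmod_mult, !Cmod_inv by exact Hz0.
    specialize (Hdl z). replace (z - 0) with z in Hdl by ring.
    replace (g z - (g 0 + l * z + 0 * z ^ 2)) with (g z - g 0 - l * z) by ring.
    specialize (Hdl ltac:(lra)).
    apply Rle_trans with (e / 8 * Cmod z * (/ Cmod z * / Cmod z))%R.
    - apply Rmult_le_compat_r; [|exact Hdl].
      apply Rmult_le_pos; left; apply Rinv_0_lt_compat; lra.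
    - replace (e / 8 * Cmod z * (/ Cmod z * / Cmod z))%R with (e / 8 * / Cmod z)%R by (field; lra).
      apply Rmult_le_compat_l; [lra|]. apply Rinv_le_contravar; lra. }
  pose proof (rectangle_integral_near_constant h (- s) s (- s) s
    (2 * (e / 8 / s)) (2 * (e / 8 / s)) 0 0) as K.
  unfold square_integral.
  match type of K with _ -> _ -> _ -> _ -> _ -> _ -> (Cmod ?u <= _)%R =>
    replace u with (rectangle_integral h (- s) s (- s) s) in K by ring end.
  eapply Rle_trans; [apply K|].
  - lra.
  - lra.
  - intros x Hx; split; apply (Hhc s); try lra; right; first [apply Rr | apply Rn]; lra.
  - intros x Hx; split; apply (Hhc s); try lra; left; first [apply Rr | apply Rn]; lra.
  - intros x Hx. replace (_ - _ - 0) with (h (x, (- s)%R) - h (x, s)) by ring.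
    eapply Rle_trans; [apply Cmod_triangle_minus|].
    pose proof (Hb x s Hx ltac:(lra) (or_intror (Rr s (proj1 Hs)))).
    pose proof (Hb x (- s)%R Hx ltac:(lra) (or_intror (Rn s (proj1 Hs)))). lra.
  - intros y Hy. replace (_ - _ - 0) with (h (s, y) - h ((- s)%R, y)) by ring.
    eapply Rle_trans; [apply Cmod_triangle_minus|].
    pose proof (Hb s y ltac:(lra) Hy (or_introl (Rr s (proj1 Hs)))).
    pose proof (Hb (- s)%R y ltac:(lra) Hy (or_introl (Rn s (proj1 Hs)))). lra.
  - apply Req_le. field. lra. }
set (q := fun z : C => (g z - g 0) * (/ z * / z)).
assert (HM : forall x y, (- r <= x <= r)%R -> (- r <= y <= r)%R ->
  (Rabs x = r \/ Rabs y = r) -> (Cmod (q (x, y)) <= 2 * M / r ^ 2)%R).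
{ intros x y Hx Hy Hxy. set (z := ((x, y) : C)).
  assert (Hz : (r <= Cmod z)%R) by (apply Cmod_ge_on_square_boundary; lra).
  assert (Hz0 : z <> 0) by (apply Cmod_gt_0; lra).
  assert (Hx' : (Rabs (fst z) <= r)%R) by (apply Rabs_le; exact Hx).
  assert (Hy' : (Rabs (snd z) <= r)%R) by (apply Rabs_le; exact Hy).
  pose proof (proj2 (Hg z Hx' Hy')) as M1.
  assert (M0 : (Cmod (g 0) <= M)%R).
  { apply Hg; simpl; rewrite Rabs_R0; lra. }
  unfold q. rewrite !Cmod_mult, !Cmod_inv by exact Hz0.
  replace (2 * M / r ^ 2)%R with (2 * M * (/ r * / r))%R by (field; lra).
  assert (Hi : (/ Cmod z <= / r)%R) by (apply Rinv_le_contravar; lra).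
  assert (Hi0 : (0 < / Cmod z)%R) by (apply Rinv_0_lt_compat; lra).
  apply Rmult_le_compat; [apply Cmod_ge_0|nra| |nra].
  eapply Rle_trans; [apply Cmod_triangle_minus|]. lra. }
assert (Hhq : forall z : C, z <> 0 -> h z = q z - l * / z).
{ intros z Hz. unfold h, q. field. exact Hz. }
pose proof (rectangle_integral_near_constant h (- r) r (- r) r
  (4 * M / r ^ 2 + Cmod l * / (2 * r)) (4 * M / r ^ 2 + Cmod l * / (2 * r))
  (- l * (Ci * RtoC (3 / (2 * r)))) (- l * RtoC (3 / (2 * r)))) as K.
fold (square_integral h r) in K. rewrite Hzero in K.
match type of K with _ -> _ -> _ -> _ -> _ -> _ -> (Cmod ?u <= _)%R =>
  assert (Eu : u = (Ci * RtoC 6) * l) end.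
{ rewrite !RtoC_minus, RtoC_div, RtoC_mult, RtoC_opp by lra.
  field. intros E. apply RtoC_inj in E. lra. }
rewrite Eu, !Cmod_mult, Cmod_Ci, Cmod_R, (Rabs_pos_eq 6) in K by lra.
assert (K' : (1 * 6 * Cmod l <= 4 * r * (4 * M / r ^ 2 + Cmod l * / (2 * r)))%R).
{ eapply Rle_trans; [apply K|apply Req_le; ring].
  - lra.
  - lra.
  - intros x Hx; split; apply (Hhc r); try lra; right; first [apply Rr | apply Rn]; lra.
  - intros x Hx; split; apply (Hhc r); try lra; left; first [apply Rr | apply Rn]; lra.
  - intros x Hx.
    assert (N1 : ((x, (- r)%R) : C) <> 0) by (intros E; injection E; lra).
    assert (N2 : ((x, r) : C) <> 0) by (intros E; injection E; lra).
    rewrite !Hhq by assumption.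
    replace (_ - _ - _) with
      (q (x, (- r)%R) - q (x, r) - l * Ci * RtoC (2 * r / (r ^ 2 + x ^ 2) - 3 / (2 * r))).
    2:{ assert (E : / ((x, (- r)%R) : C) - / ((x, r) : C) = Ci * RtoC (2 * r / (r ^ 2 + x ^ 2))).
        { unfold Cinv, Cminus, Cplus, Copp, Ci, RtoC, Cmult; simpl; f_equal; field; nra. }
        rewrite RtoC_minus.
        transitivity (q (x, (- r)%R) - q (x, r) - l * (Ci * RtoC (2 * r / (r ^ 2 + x ^ 2)))
          + l * (Ci * RtoC (3 / (2 * r)))); [ring|]. rewrite <- E. ring. }
    eapply Rle_trans; [apply Cmod_triangle_minus|].
    apply Rplus_le_compat.
    + eapply Rle_trans; [apply Cmod_triangle_minus|].
      pose proof (HM x r Hx ltac:(lra) (or_intror (Rr r Hr))).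
      pose proof (HM x (- r)%R Hx ltac:(lra) (or_intror (Rn r Hr))). lra.
    + rewrite !Cmod_mult, Cmod_Ci, Cmod_R, Rmult_1_r.
      apply Rmult_le_compat_l; [apply Cmod_ge_0|]. apply Rabs_kernel_minus_mean; assumption.
  - intros y Hy.
    assert (N1 : (((- r)%R, y) : C) <> 0) by (intros E; injection E; lra).
    assert (N2 : ((r, y) : C) <> 0) by (intros E; injection E; lra).
    rewrite !Hhq by assumption.
    replace (_ - _ - _) with
      (q (r, y) - q ((- r)%R, y) - l * RtoC (2 * r / (r ^ 2 + y ^ 2) - 3 / (2 * r))).
    2:{ assert (E : / ((r, y) : C) - / (((- r)%R, y) : C) = RtoC (2 * r / (r ^ 2 + y ^ 2))).
        { unfold Cinv, Cminus, Cplus, Copp, RtoC; simpl; f_equal; field; nra. }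
        rewrite RtoC_minus, <- E. ring. }
    eapply Rle_trans; [apply Cmod_triangle_minus|].
    apply Rplus_le_compat.
    + eapply Rle_trans; [apply Cmod_triangle_minus|].
      pose proof (HM r y ltac:(lra) Hy (or_introl (Rr r Hr))).
      pose proof (HM (- r)%R y ltac:(lra) Hy (or_introl (Rn r Hr))). lra.
    + rewrite !Cmod_mult, Cmod_R.
      apply Rmult_le_compat_l; [apply Cmod_ge_0|]. apply Rabs_kernel_minus_mean; assumption. }
replace (4 * r * (4 * M / r ^ 2 + Cmod l * / (2 * r)))%R with (16 * M / r + 2 * Cmod l)%R in K'
  by (field; lra).
assert (K2 : (4 * Cmod l <= 16 * M / r)%R) by lra.
apply Rle_div_r in K2; lra.
Qed.

(** A disc of radius [2 r] contains the square of half-side [r]. *)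
Theorem cauchy_estimate (g : C -> C) (w l : C) (r M : R) :
  (0 < r)%R ->
  (forall z : C, (Cmod (z - w) <= 2 * r)%R ->
     (exists m, has_cderiv g z m) /\ (Cmod (g z) <= M)%R) ->
  has_cderiv g w l ->
  (Cmod l * r <= 4 * M)%R.
Proof.
intros Hr Hg Hl.
apply (cauchy_estimate_origin (fun z => g (w + z)) l r M Hr).
- intros z Hx Hy.
  destruct (Hg (w + z)) as [[m Hm] HM].
  + replace (w + z - w) with z by ring.
    eapply Rle_trans; [apply Cmod_le_Rabs_sum|]. lra.
  + split; [exists m; apply has_cderiv_translate, Hm|exact HM].
- apply has_cderiv_translate. replace (w + 0) with w by ring. exact Hl.
Qed.

(** * The derivative of a holomorphic map near 0 *)

(** Cauchy's estimate for the remainder [g = o(z^2)] with [r = |w|]: the disc of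
    radius [2 |w|] about [w] stays within [|z| <= 3 |w|], so that
    [|g' w| |w| <= 4 * 9 * (eps / 36) |w|^2]. *)
Lemma derivative_of_quadratic_expansion (f df : C -> C) (c : C) (rho : R) :
  (0 < rho)%R ->
  (forall z : C, (Cmod z < rho)%R -> has_cderiv f z (df z)) ->
  df 0 = 1 ->
  quadratic_expansion f c ->
  has_cderiv df 0 (2 * c).
Proof.
intros Hrho Hdf Hdf0 Hexp eps Heps.
destruct (proj1 (quadratic_expansion_Cmod f c) Hexp (eps / 36)%R ltac:(lra)) as [d [Hd Hfd]].
exists (Rmin rho d / 3)%R.
assert (Hm : (0 < Rmin rho d)%R) by (apply Rmin_glb_lt; assumption).
split; [lra|].
intros w Hw. rewrite Hdf0. replace (w - 0) with w in * by ring.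
pose proof (Rmin_l rho d) as Hm1. pose proof (Rmin_r rho d) as Hm2.
destruct (Req_dec (Cmod w) 0) as [Hw0|Hw0].
{ rewrite Hw0. apply Cmod_eq_0 in Hw0. subst w. rewrite Hdf0.
  replace (1 - 1 - 2 * c * 0) with (RtoC 0) by ring. rewrite Cmod_0. lra. }
assert (Hwpos : (0 < Cmod w)%R) by (pose proof (Cmod_ge_0 w); lra).
set (g := fun z : C => f z - (0 + 1 * z + c * z ^ 2)).
assert (Hg : forall z, (Cmod z < rho)%R -> has_cderiv g z (df z - (1 + c * (2 * z)))).
{ intros z Hz. apply has_cderiv_minus; [apply Hdf, Hz|apply has_cderiv_polynomial]. }
pose proof (cauchy_estimate g w (df w - (1 + c * (2 * w))) (Cmod w) (eps / 36 * (3 * Cmod w) ^ 2) Hwpos) as K.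
replace (df w - 1 - 2 * c * w) with (df w - (1 + c * (2 * w))) by ring.
apply Rmult_le_reg_r with (Cmod w); [exact Hwpos|].
eapply Rle_trans; [apply K|].
- intros z Hz.
  assert (Hz3 : (Cmod z <= 3 * Cmod w)%R).
  { pose proof (Cmod_reverse_triangle z w). lra. }
  split; [eexists; apply Hg; lra|].
  unfold g. replace (0 + 1 * z + c * z ^ 2) with (z + c * z ^ 2) by ring.
  eapply Rle_trans; [apply Hfd; lra|].
  apply Rmult_le_compat_l; [lra|]. apply pow_incr. split; [apply Cmod_ge_0|exact Hz3].
- apply Hg. lra.
- apply Req_le. field.
Qed.

Lemma holomorphic_derivative_at_0 (U : C -> Prop) (f : C -> C) (c : C) :
  locally (RtoC 0) U -> holomorphic_on U f -> is_derive f (RtoC 0) (RtoC 1) ->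
  quadratic_expansion f c ->
  (exists rho : R, (0 < rho)%R /\ forall z, (Cmod z < rho)%R -> has_cderiv f z (C_derive f z)) /\
  has_cderiv (C_derive f) 0 (2 * c).
Proof.
intros HU Hf Hd Hexp.
assert (HUl : locally (RtoC 0) (fun z => locally z U)) by (apply locally_locally, HU).
apply locally_Cmod in HUl. destruct HUl as [rho [Hrho HUl]].
assert (HD : forall z, (Cmod z < rho)%R -> has_cderiv f z (C_derive f z)).
{ intros z Hz. apply is_derive_has_cderiv, C_derive_correct; [exact z|].
  apply Hf, HUl. replace (z - 0) with z by ring. exact Hz. }
split; [exists rho; split; assumption|].
apply (derivative_of_quadratic_expansion f (C_derive f) c rho Hrho HD); [|exact Hexp].
apply is_C_derive_unique, Hd.
Qed.

(** * Local surjectivity *)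

(** Minimise [|f z - w|] over the square of half-side [rho / 3].  The value at 0
    is [|w|], so a minimiser satisfies [|z| / 2 <= |f z| <= 2 |w|] and is
    interior.  If [f z <> w], the step [h = t (w - f z) / l], with [l] the
    derivative, changes [f z - w] into [(1 - t) (f z - w)] up to an error of at
    most half of what was gained, contradicting minimality. *)
Theorem local_surjectivity (f : C -> C) (rho : R) :
  (0 < rho)%R ->
  (forall z, (Cmod z < rho)%R -> exists l : C, l <> 0 /\ has_cderiv f z l) ->
  (forall z, (Cmod z < rho)%R -> (Cmod z / 2 <= Cmod (f z))%R) ->
  f 0 = 0 ->
  forall w, (Cmod w < rho / 12)%R -> exists z, (Cmod z <= 4 * Cmod w)%R /\ f z = w.
Proof.
intros Hrho Hd Hlow Hf0 w Hw.
set (s := (rho / 3)%R).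
assert (Hin : forall x y, (- s <= x <= s)%R -> (- s <= y <= s)%R -> (Cmod ((x, y) : C) < rho)%R).
{ intros x y Hx Hy. eapply Rle_lt_trans; [apply Cmod_le_Rabs_sum|]. simpl.
  assert (Rabs x <= s)%R by (apply Rabs_le; lra).
  assert (Rabs y <= s)%R by (apply Rabs_le; lra). unfold s in *; lra. }
destruct (lower_semicontinuous_attains_min (fun z => Cmod (f z - w)) (- s) s (- s) s)
  as [x0 [y0 [Hx0 [Hy0 Hmin]]]].
- unfold s; lra.
- unfold s; lra.
- intros x y v Hx Hy Hv. destruct (Hd _ (Hin x y Hx Hy)) as [l [_ Hl]].
  destruct (continuous_Cmod f _ (Cmod (f (x, y) - w) - v)
    (has_cderiv_continuous _ _ _ Hl) ltac:(lra)) as [delta [Hdl Hz]].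
  exists delta. split; [exact Hdl|]. intros z Hzd. specialize (Hz z Hzd).
  pose proof (Cmod_reverse_triangle (f (x, y) - w) (f z - w)) as K.
  replace (f (x, y) - w - (f z - w)) with (- (f z - f (x, y))) in K by ring.
  rewrite Cmod_opp in K. lra.
- set (z0 := ((x0, y0) : C)) in *.
  pose proof (Hin x0 y0 Hx0 Hy0) as Hz0. fold z0 in Hz0.
  assert (Hsmall : (Cmod z0 <= 4 * Cmod w)%R).
  { assert (K : (Cmod (f z0 - w) <= Cmod w)%R).
    { rewrite <- (Cmod_opp w). replace (- w) with (f 0 - w) by (rewrite Hf0; ring).
      apply Hmin; unfold s; lra. }
    pose proof (Cmod_reverse_triangle (f z0) w). pose proof (Hlow z0 Hz0). lra. }
  exists z0. split; [exact Hsmall|].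
  apply NNPP; intros Hne.
  destruct (Hd z0 Hz0) as [l [Hl0 Hl]].
  assert (Hlpos : (0 < Cmod l)%R) by (apply Cmod_gt_0, Hl0).
  set (e := w - f z0).
  assert (He : (0 < Cmod e)%R).
  { apply Cmod_gt_0. intros E. apply Hne. unfold e in E.
    transitivity (w - (w - f z0)); [ring|]. rewrite E. ring. }
  destruct (Hl (Cmod l / 2)%R ltac:(lra)) as [delta [Hdl Hz]].
  set (k := (Cmod e / Cmod l)%R).
  assert (Hk : (0 < k)%R) by (apply Rdiv_lt_0_compat; assumption).
  set (eta := Rmin delta (s - 4 * Cmod w)).
  assert (Heta : (0 < eta)%R) by (apply Rmin_glb_lt; unfold s; lra).
  (* [|h| = t k < eta] keeps the step inside the square and inside the disc
     where the derivative approximates [f] *)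
  set (t := Rmin 1 (eta / (2 * k))).
  assert (Ht : (0 < t)%R) by (apply Rmin_glb_lt; [lra|apply Rdiv_lt_0_compat; lra]).
  assert (Ht1 : (t <= 1)%R) by apply Rmin_l.
  assert (Htk : (t * k < eta)%R).
  { assert (K : (t <= eta / (2 * k))%R) by apply Rmin_r.
    apply Rle_div_r in K; lra. }
  set (h := RtoC t * e / l).
  assert (Hh : (Cmod h = t * k)%R).
  { unfold h, k. rewrite Cmod_div, Cmod_mult, Cmod_R, Rabs_pos_eq by (assumption || lra).
    unfold Rdiv; ring. }
  pose proof (Rmin_l delta (s - 4 * Cmod w)) as E1.
  pose proof (Rmin_r delta (s - 4 * Cmod w)) as E2. fold eta in E1, E2.
  specialize (Hz (z0 + h)). replace (z0 + h - z0) with h in Hz by ring.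
  specialize (Hz ltac:(lra)).
  assert (Hlt : (Cmod (f (z0 + h)%C - w) < Cmod e)%R).
  { replace (f (z0 + h) - w) with ((f (z0 + h) - f z0 - l * h) - RtoC (1 - t) * e).
    2:{ rewrite RtoC_minus. unfold h, e. field. exact Hl0. }
    eapply Rle_lt_trans; [apply Cmod_triangle_minus|].
    rewrite Cmod_mult, Cmod_R, Rabs_pos_eq by lra.
    assert (E : (Cmod l / 2 * Cmod h = t * Cmod e / 2)%R).
    { rewrite Hh. unfold k. field. lra. }
    nra. }
  assert (Hge : (Cmod e <= Cmod (f (z0 + h)%C - w))%R).
  { unfold e. replace (w - f z0) with (- (f z0 - w)) by ring. rewrite Cmod_opp.
    assert (Hzh : (Cmod (z0 + h) < s)%R) by (pose proof (Cmod_triangle z0 h); lra).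
    pose proof (Rabs_fst_le_Cmod (z0 + h)) as F1. pose proof (Rabs_snd_le_Cmod (z0 + h)) as F2.
    destruct (z0 + h) as [x1 y1]. simpl in F1, F2.
    apply Hmin; apply Rabs_le_between; lra. }
  lra.
Qed.

(** Differentiability of [f'] at 0 is used through continuity only: as
    [f' 0 = 1], the derivative does not vanish near 0. *)
Lemma holomorphic_locally_onto (U : C -> Prop) (f : C -> C) (c : C) :
  locally (RtoC 0) U -> holomorphic_on U f -> f 0 = 0 -> is_derive f (RtoC 0) (RtoC 1) ->
  quadratic_expansion f c ->
  exists rho : R, (0 < rho)%R /\
    forall w, (Cmod w < rho)%R -> exists z, (Cmod z <= 4 * Cmod w)%R /\ f z = w.
Proof.
intros HU Hf Hf0 Hd Hexp.
destruct (holomorphic_derivative_at_0 U f c HU Hf Hd Hexp) as [[r1 [Hr1 HD]] HD2].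
destruct (Cmod_le_twice_near_0 f Hf0 (proj1 (is_derive_has_cderiv _ _ _) Hd)) as [r2 [Hr2 H2]].
destruct (continuous_Cmod _ _ 1 (has_cderiv_continuous _ _ _ HD2) Rlt_0_1) as [r3 [Hr3 H3]].
set (rho := Rmin r1 (Rmin r2 r3)).
assert (Hrho : (0 < rho)%R) by (repeat apply Rmin_glb_lt; assumption).
assert (L1 : (rho <= r1)%R) by apply Rmin_l.
assert (L2 : (rho <= r2)%R) by (eapply Rle_trans; [apply Rmin_r|apply Rmin_l]).
assert (L3 : (rho <= r3)%R) by (eapply Rle_trans; [apply Rmin_r|apply Rmin_r]).
exists (rho / 12)%R. split; [lra|].
apply (local_surjectivity f rho Hrho); trivial.
- intros z Hz. exists (C_derive f z). split; [|apply HD; lra].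
  intros E. specialize (H3 z). replace (z - 0) with z in H3 by ring.
  specialize (H3 ltac:(lra)).
  rewrite E, (is_C_derive_unique f 0 1 Hd) in H3.
  replace (0 - 1) with (- (1)) in H3 by ring. rewrite Cmod_m1 in H3. lra.
- intros z Hz. apply H2. lra.
Qed.

(** * Expansion of the composition *)

(** Here [g o u = f]; the bound [|u z| <= 8 |z|] lets errors in [u z] be
    measured by [z]. *)
Lemma quadratic_expansion_of_lift (f g u : C -> C) (a b : C) (r : R) :
  (0 < r)%R ->
  (forall z, (Cmod z < r)%R -> (Cmod (u z) <= 8 * Cmod z)%R /\ g (u z) = f z) ->
  quadratic_expansion f a -> quadratic_expansion g b ->
  quadratic_expansion u (a - b).
Proof.
intros Hr Hu Hf Hg. apply quadratic_expansion_Cmod. intros eps Heps.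
destruct (proj1 (quadratic_expansion_Cmod f a) Hf (eps / 3)%R ltac:(lra)) as [d1 [Hd1 H1]].
destruct (proj1 (quadratic_expansion_Cmod g b) Hg (eps / 192)%R ltac:(lra)) as [d2 [Hd2 H2]].
(* [K] bounds [|u z - z| / |z|^2]; then
   [|b (u^2 - z^2)| <= |b| K |z|^2 * 9 |z|], which is at most
   [(eps / 3) |z|^2] as soon as [|z| <= eps / B] *)
set (K := (Cmod a + 64 * Cmod b + eps)%R).
assert (HK : (0 < K)%R) by (pose proof (Cmod_ge_0 a); pose proof (Cmod_ge_0 b); unfold K; lra).
set (B := (27 * (Cmod b + 1) * K)%R).
assert (HB : (0 < B)%R) by (pose proof (Cmod_ge_0 b); unfold B; nra).
set (d := Rmin r (Rmin d1 (Rmin (d2 / 8) (eps / B)))).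
exists d. split.
{ unfold d; repeat apply Rmin_glb_lt; try lra. apply Rdiv_lt_0_compat; assumption. }
intros z Hz.
assert (Hdd : (d <= r /\ d <= d1 /\ d <= d2 / 8 /\ d <= eps / B)%R).
{ unfold d.
  pose proof (Rmin_l r (Rmin d1 (Rmin (d2 / 8) (eps / B)))).
  pose proof (Rmin_r r (Rmin d1 (Rmin (d2 / 8) (eps / B)))).
  pose proof (Rmin_l d1 (Rmin (d2 / 8) (eps / B))).
  pose proof (Rmin_r d1 (Rmin (d2 / 8) (eps / B))).
  pose proof (Rmin_l (d2 / 8) (eps / B)).
  pose proof (Rmin_r (d2 / 8) (eps / B)).
  lra. }
destruct Hdd as [D0 [D1 [D2 D4]]].
destruct (Hu z ltac:(lra)) as [Hu8 Hgu].
specialize (H1 z ltac:(lra)). specialize (H2 (u z) ltac:(lra)).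
set (v := u z) in *. rewrite Hgu in H2.
set (E1 := f z - (z + a * z ^ 2)) in *.
set (E2 := f z - (v + b * v ^ 2)) in *.
pose proof (Cmod_ge_0 z) as Pz. pose proof (Cmod_ge_0 v) as Pv.
assert (Pv2 : (Cmod v ^ 2 <= 64 * Cmod z ^ 2)%R) by nra.
assert (Hvz : (Cmod (v - z) <= K * Cmod z ^ 2)%R).
{ replace (v - z) with ((a * z ^ 2 - b * v ^ 2) + (E1 - E2)) by (unfold E1, E2; ring).
  eapply Rle_trans; [apply Cmod_triangle|].
  eapply Rle_trans; [apply Rplus_le_compat; apply Cmod_triangle_minus|].
  rewrite !Cmod_mult, !Cmod_pow.
  pose proof (Rmult_le_compat_l _ _ _ (Cmod_ge_0 b) Pv2).
  unfold K. nra. }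
replace (v - (z + (a - b) * z ^ 2)) with (E1 - E2 - b * ((v - z) * (v + z)))
  by (unfold E1, E2; ring).
eapply Rle_trans; [apply Cmod_triangle_minus|].
assert (HE : (Cmod (E1 - E2) <= 2 / 3 * eps * Cmod z ^ 2)%R).
{ eapply Rle_trans; [apply Cmod_triangle_minus|]. nra. }
assert (HQ : (Cmod (b * ((v - z) * (v + z))) <= eps / 3 * Cmod z ^ 2)%R).
{ rewrite !Cmod_mult.
  assert (Hs : (Cmod (v + z) <= 9 * Cmod z)%R) by (pose proof (Cmod_triangle v z); lra).
  apply Rle_trans with ((Cmod b + 1) * (K * Cmod z ^ 2 * (9 * Cmod z)))%R.
  - apply Rmult_le_compat; try apply Cmod_ge_0; try lra.
    + apply Rmult_le_pos; apply Cmod_ge_0.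
    + apply Rmult_le_compat; try apply Cmod_ge_0; assumption.
  - assert (Hzb : (Cmod z * B <= eps)%R).
    { apply Rle_div_r; lra. }
    replace ((Cmod b + 1) * (K * Cmod z ^ 2 * (9 * Cmod z)))%R
      with (Cmod z * B / 3 * Cmod z ^ 2)%R by (unfold B; field).
    apply Rmult_le_compat_r; [apply pow2_ge_0|lra]. }
lra.
Qed.

Theorem proposition4p1
  (U : C -> Prop) (phi psi : C -> C) (a b : C)
  (hU : locally (RtoC 0) U)
  (hphi : conformal_on U phi) (hpsi : conformal_on U psi)
  (hphi0 : phi 0 = 0) (hpsi0 : psi 0 = 0)
  (hdphi : is_derive phi (RtoC 0) (RtoC 1)) (hdpsi : is_derive psi (RtoC 0) (RtoC 1))
  (hphi_exp : quadratic_expansion phi a)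
  (hpsi_exp : quadratic_expansion psi b) :
  (exists psi_inv : C -> C, local_inverse_at_0 U psi psi_inv) /\
  (forall psi_inv : C -> C, local_inverse_at_0 U psi psi_inv ->
     locally (RtoC 0)
       (fun z : C => U (psi_inv (phi z)) /\ psi (psi_inv (phi z)) = phi z) /\
     quadratic_expansion (fun z : C => psi_inv (phi z)) (a - b)) /\
  (exists phi2 psi2 : C,
     is_derive (C_derive phi) (RtoC 0) phi2 /\
     is_derive (C_derive psi) (RtoC 0) psi2 /\
     a - b = (phi2 - psi2) / 2).
Proof.
destruct hphi as [hphih _]. destruct hpsi as [hpsih hpsii].
destruct (holomorphic_locally_onto U psi b hU hpsih hpsi0 hdpsi hpsi_exp) as [r1 [Hr1 Honto]].
assert (HU : exists r, (0 < r)%R /\ forall z, (Cmod z < r)%R -> U z).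
{ apply locally_Cmod in hU. destruct hU as [r [Hr H]]. exists r; split; [exact Hr|].
  intros z Hz. apply H. replace (z - 0) with z by ring. exact Hz. }
destruct HU as [r2 [Hr2 HU]].
repeat split.
(* the inverse picks a preimage in [U] when there is one; injectivity makes it
   a left inverse, local surjectivity a right inverse *)
- assert (Hg : forall w, exists z, (exists z', U z' /\ psi z' = w) -> U z /\ psi z = w).
  { intros w. destruct (classic (exists z', U z' /\ psi z' = w)) as [[z Hz]|Hz].
    - exists z; intros _; exact Hz.
    - exists 0; intros K; contradiction. }
  set (g := fun w => proj1_sig (constructive_indefinite_description _ (Hg w))).
  assert (Hgs : forall w z, U z -> psi z = w -> U (g w) /\ psi (g w) = w).
  { intros w z Hz Hw.
    apply (proj2_sig (constructive_indefinite_description _ (Hg w))). exists z; tauto. }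
  assert (Hinv : forall z, U z -> g (psi z) = z).
  { intros z Hz. destruct (Hgs (psi z) z Hz eq_refl) as [H1 H2].
    apply hpsii; assumption. }
  exists g. split; [|split].
  + rewrite <- hpsi0 at 1. apply Hinv, HU. rewrite Cmod_0. exact Hr2.
  + apply locally_Cmod. exists r2. split; [exact Hr2|]. intros z Hz.
    apply Hinv, HU. replace z with (z - 0) by ring. exact Hz.
  + apply locally_Cmod. exists (Rmin r1 (r2 / 4)). split; [apply Rmin_glb_lt; lra|].
    intros w Hw. replace (w - 0) with w in Hw by ring.
    pose proof (Rmin_l r1 (r2 / 4)). pose proof (Rmin_r r1 (r2 / 4)).
    destruct (Honto w ltac:(lra)) as [z [Hz Hzw]].
    apply (Hgs w z); [apply HU; lra|exact Hzw].
- destruct H as [_ [_ H]].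
  pose proof (has_cderiv_continuous _ _ _ (proj1 (is_derive_has_cderiv _ _ _) hdphi)) as Hc.
  apply (Hc (fun w => U (psi_inv w) /\ psi (psi_inv w) = w)). rewrite hphi0. exact H.
- destruct H as [_ [H1 H2]].
  assert (Hc : continuous phi (RtoC 0)) by
    exact (has_cderiv_continuous _ _ _ (proj1 (is_derive_has_cderiv _ _ _) hdphi)).
  assert (H3 : locally (RtoC 0) (fun z => psi (psi_inv (phi z)) = phi z)).
  { apply (Hc (fun w => psi (psi_inv w) = w)). rewrite hphi0. revert H2. apply filter_imp. tauto. }
  apply locally_Cmod in H1. destruct H1 as [r3 [Hr3 H1]].
  apply locally_Cmod in H3. destruct H3 as [r4 [Hr4 H3]].
  destruct (Cmod_le_twice_near_0 phi hphi0 (proj1 (is_derive_has_cderiv _ _ _) hdphi))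
    as [r5 [Hr5 H5]].
  set (r := Rmin (Rmin r1 (r3 / 4) / 2) (Rmin r4 r5)).
  assert (Hm : (0 < Rmin r1 (r3 / 4))%R) by (apply Rmin_glb_lt; lra).
  apply (quadratic_expansion_of_lift phi psi _ a b r); trivial.
  + unfold r. repeat apply Rmin_glb_lt; lra.
  + intros z Hz.
    pose proof (Rmin_l r1 (r3 / 4)). pose proof (Rmin_r r1 (r3 / 4)).
    pose proof (Rmin_l (Rmin r1 (r3 / 4) / 2) (Rmin r4 r5)).
    pose proof (Rmin_r (Rmin r1 (r3 / 4) / 2) (Rmin r4 r5)).
    pose proof (Rmin_l r4 r5). pose proof (Rmin_r r4 r5).
    unfold r in Hz.
    assert (Hp : (Cmod (phi z) <= 2 * Cmod z)%R) by (apply H5; lra).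
    split.
    (* any local inverse sends [phi z] to its small preimage, so that
       [|psi_inv (phi z)| <= 4 |phi z| <= 8 |z|] *)
    * destruct (Honto (phi z)) as [y [Hy Hyz]]; [lra|].
      rewrite <- Hyz, H1; [lra|].
      replace (y - 0) with y by ring. lra.
    * apply H3. replace (z - 0) with z by ring. lra.
- exists (2 * a), (2 * b). split; [|split].
  + apply is_derive_has_cderiv.
    apply (holomorphic_derivative_at_0 U phi a); trivial.
  + apply is_derive_has_cderiv.
    apply (holomorphic_derivative_at_0 U psi b); trivial.
  + field.
Qed.
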